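(* Let $K$ be a finite simplicial complex. Then for every $n\ge0$ the group $\mathcal{H}^{n,n}(K)$ is free, and $\mathrm{rank}\,\mathcal{H}^{n,n}(K)$ equals the number of $n$-dimensional completely connected components of $K$.
   Context: A (finite, abstract) simplicial complex $K$ with finite vertex set $S$ is a collection of subsets of $S$ (simplices) containing every $\{v\}$, $v\in S$, and closed under passing to subsets; in particular $\varnothing\in K$. $|\sigma|$ denotes the cardinality of $\sigma$, $\dim\sigma=|\sigma|-1$, and $\dim K$ is the maximal dimension of its simplices. $K$ is completely connected if for any two simplices $\sigma,\sigma'$ of $K$ of the same dimension there is a sequence $\sigma_0,\sigma_1,\dots,\sigma_m$ of simplices of $K$ with $\sigma_0=\sigma$, $\sigma_m=\sigma'$, $|\sigma_i|=|\sigma|$ for all $i$, and such that $\sigma_i,\sigma_{i+1}$ share a common facet (codimension-one face) for each $i$. A completely connected component of $K$ is a maximal completely connected subcomplex of $K$. $C_n(K)=C^n(K)$ ($n\ge 0$) is the group of oriented simplicial $n$-chains: generated by ordered sequences $(v_0,\dots,v_n)$ of vertices, alternating in the entries, and zero if an entry is repeated or $\{v_0,\dots,v_n\}\notin K$. $C_*(K)=C^*(K)=\bigoplus_{k\ge0}C_k(K)$ carries the usual simplicial boundary $d$ (zero on $C_0$) and the coboundary $\delta(v_0,\dots,v_k)=\sum_{v\in S}(v,v_0,\dots,v_k)$. $N^{p,q}(K)\subset C_p(K)\otimes C^q(K)$ is the subgroup generated by all $\sigma\otimes\tau$ with $\sigma\subset\tau$, with differential $\Delta(\sigma\otimes\tau)=(d\sigma)\otimes\tau+(-1)^{|\sigma|}\sigma\otimes(\delta\tau)$,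 and total complex $T^n(N(K))=\bigoplus_{q-p=n}N^{p,q}(K)$. The filtration $F^p=\bigoplus_{i\le p}N^{i,*}(K)$ yields the cohomeology spectral sequence with $E_1^{p,q}(K)=H^{q-p}(F^p/F^{p-1})$, $\Delta_r\colon E_r^{p,q}\to E_r^{p-r,q-r+1}$; the cohomeology groups are $\mathcal{H}^{p,q}(K)=E_2^{p,q}(K)$.
   Formalization: For n=0 the count fails as stated (two isolated points share the facet ∅: one component, but rank 2); the formal theorem proves it literally for n>0, and for all n≥0 with components maximal among connected, completely connected subcomplexes (isolated vertices when n=0). *)

(* Defs.v *)
From HB Require Import structures.
From mathcomp Require Import all_boot all_order all_algebra.
From mathcomp Require Import ring_quotient boolp.

Set Implicit Arguments.
Unset Strict Implicit.
Unset Printing Implicit Defensive.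

Import Order.TTheory GRing.Theory Num.Theory.
Local Open Scope ring_scope.

Definition simplicial_complex (S : finType) (K : {set {set S}}) : bool :=
  [&& set0 \in K,
      [forall v : S, [set v] \in K]
    & [forall s in K, forall t : {set S}, (t \subset s) ==> (t \in K)]].

(* The vertex set of a subcomplex L consists of the v such that [set v] \in L,
   so it may be smaller than S. *)
Definition subcomplex (S : finType) (K L : {set {set S}}) : bool :=
  [&& set0 \in L, L \subset K
    & [forall s in L, forall t : {set S}, (t \subset s) ==> (t \in L)]].

(* dim L = n; stated without subtraction so that dim [set set0] = -1 does not
   collapse to 0. *)
Definition of_dim (S : finType) (L : {set {set S}}) (n : nat) : bool :=
  (\max_(s in L) #|s| == n.+1)%N.

Definition facet (S : finType) (r s : {set S}) : bool :=
  (r \subset s) && (#|s| == #|r|.+1).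

Definition share_facet (S : finType) (s t : {set S}) : bool :=
  [exists r : {set S}, facet r s && facet r t].

Definition completely_connected (S : finType) (L : {set {set S}}) : bool :=
  [forall s in L, forall t in L, (#|s| == #|t|) ==>
     connect [rel a b | [&& a \in L, b \in L, #|a| == #|s|, #|b| == #|s|
                          & share_facet a b]] s t].

Definition edge_connected (S : finType) (L : {set {set S}}) : bool :=
  [forall v : S, forall w : S, ([set v] \in L) ==> ([set w] \in L) ==>
     connect [rel a b | [set a; b] \in L] v w].

Definition cc_components (S : finType) (K : {set {set S}}) (n : nat) :
    {set {set {set S}}} :=
  [set L | maxset (fun M => subcomplex K M && completely_connected M) L
         & of_dim L n].

(* [set0] is a facet of every vertex, so any discrete set of points is
   completely_connected and would count as a single component of dimension 0.
   Requiring connectedness as well makes the components of dimension 0 exactly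
   the isolated vertices, and does not change how many components there are in
   any positive dimension. *)
Definition connected_cc_components (S : finType) (K : {set {set S}}) (n : nat) :
    {set {set {set S}}} :=
  [set L | maxset (fun M => [&& subcomplex K M, completely_connected M
                              & edge_connected M]) L
         & of_dim L n].

Definition simplex (S : finType) (K : {set {set S}}) : finType :=
  {s : {set S} | (s \in K) && (s != set0)}.

(* The free abelian group C_*(K) = C^*(K) on the nonempty simplices, each
   oriented by the order of [enum S]. *)
Notation chain K := {ffun simplex K -> int}.

(* The free abelian group C_*(K) (x) C^*(K). *)
Notation bichain K := {ffun simplex K * simplex K -> int}.

Fixpoint inversions (S : finType) (s : seq S) : nat :=
  if s is v :: s' then
    (count (fun u => (enum_rank u < enum_rank v)%N) s' + inversions s')%N
  else 0%N.

(* The generator (v_0, ..., v_n) of C_n(K): zero if a vertex is repeated or if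
   {v_0, ..., v_n} is not a nonempty simplex of K, and otherwise the signature
   of the sorting permutation times the underlying simplex. *)
Definition oriented (S : finType) (K : {set {set S}}) (s : seq S) : chain K :=
  [ffun t : simplex K =>
     if uniq s && (val t == [set v in s]) then (-1) ^+ inversions s else 0].

Lemma odd_inversions_swap (S : finType) (s1 s2 : seq S) (x y : S) : x != y ->
  odd (inversions (s1 ++ x :: y :: s2)) = ~~ odd (inversions (s1 ++ y :: x :: s2)).
Proof.
move=> xy; elim: s1 => [|v s1 IH] /=; last first.
  rewrite !count_cat /= !oddD IH.
  by do 5 case: (odd _).
have : enum_rank x != enum_rank y by rewrite (inj_eq enum_rank_inj).
rewrite -val_eqE /= !oddD; case: ltngtP => // _ _ /=;
  by do 3 case: (odd _).
Qed.

Lemma oriented_swap (S : finType) (K : {set {set S}}) (s1 s2 : seq S) (x y : S) :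
  oriented K (s1 ++ x :: y :: s2) = - oriented K (s1 ++ y :: x :: s2).
Proof.
have pxy : perm_eq (s1 ++ x :: y :: s2) (s1 ++ y :: x :: s2).
  by rewrite perm_cat2l; apply/permP => a /=; rewrite addnCA.
apply/ffunP => t; rewrite !ffunE (perm_uniq pxy).
have -> : [set v in s1 ++ x :: y :: s2] = [set v in s1 ++ y :: x :: s2].
  by apply/setP => v; rewrite !inE (perm_mem pxy).
case: ifP => [/andP[us _]|_]; last by rewrite oppr0.
have xy : x != y.
  by move: us; rewrite cat_uniq => /and3P[_ _ /= /andP[]]; rewrite inE; case: eqVneq.
by rewrite -signr_odd (odd_inversions_swap _ _ xy) signrN signr_odd.
Qed.

(* d (v_0, ..., v_n) = \sum_i (-1)^i (v_0, ..., ^v_i, ..., v_n). *)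
Definition boundary_seq (S : finType) (K : {set {set S}}) (s : seq S) : chain K :=
  \sum_(i < size s) oriented K (take i s ++ drop i.+1 s) *~ (-1) ^+ i.

Definition coboundary_seq (S : finType) (K : {set {set S}}) (s : seq S) :
    chain K :=
  \sum_(v : S) oriented K (v :: s).

Definition tensor (S : finType) (K : {set {set S}}) (a b : chain K) : bichain K :=
  [ffun st => a st.1 * b st.2].

(* The linear extension of
   sigma (x) tau |-> d sigma (x) tau + (-1)^|sigma| sigma (x) delta tau,
   where [enum A] lists A in increasing order, so that [oriented K (enum A)] is
   the basis element of the simplex A. *)
Definition Delta (S : finType) (K : {set {set S}}) (x : bichain K) : bichain K :=
  \sum_(st : simplex K * simplex K)
    (let s := enum (val st.1) in let t := enum (val st.2) in
     tensor (boundary_seq K s) (oriented K t)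
     + tensor (oriented K s) (coboundary_seq K t) *~ (-1) ^+ size s) *~ x st.

Lemma Delta_is_zmod_morphism (S : finType) (K : {set {set S}}) :
  zmod_morphism (@Delta S K).
Proof.
move=> x y; rewrite /Delta -sumrB; apply: eq_bigr => st _.
by rewrite !ffunE mulrzBr.
Qed.

HB.instance Definition _ (S : finType) (K : {set {set S}}) :=
  GRing.isZmodMorphism.Build (bichain K) (bichain K) (@Delta S K)
    (@Delta_is_zmod_morphism S K).

Section Subquotient.
Variables (V : zmodType) (Z B : zmodClosed V).

Definition subgroup_type : Type := {x : V | x \in Z}.
HB.instance Definition _ := SubChoice.on subgroup_type.
HB.instance Definition _ := [SubChoice_isSubZmodule of subgroup_type by <:].

Definition pullback : {pred subgroup_type} := fun x => val x \in B.

Lemma pullback_zmod_closed : zmod_closed pullback.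
Proof.
split=> [|x y xB yB]; first by rewrite /pullback unfold_in raddf0 rpred0.
by rewrite unfold_in /pullback raddfB rpredB.
Qed.

HB.instance Definition _ :=
  GRing.isZmodClosed.Build subgroup_type pullback pullback_zmod_closed.

(* Z / B, or more precisely Z / (Z \cap B). *)
Definition subquotient : zmodType := Quotient.quot pullback.
End Subquotient.

Definition sdim (S : finType) (K : {set {set S}}) (s : simplex K) : int :=
  #|val s|%:Z - 1.

(* F^p T^n(N(K)): combinations of sigma (x) tau with sigma \subset tau,
   dim tau - dim sigma = n and dim sigma <= p. *)
Definition filtered (S : finType) (K : {set {set S}}) (p n : int) :
    {pred bichain K} :=
  fun x => [forall st : simplex K * simplex K, (x st != 0) ==>
    [&& val st.1 \subset val st.2, sdim st.2 - sdim st.1 == n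
      & sdim st.1 <= p]].

(* Z_r^p = F^p \cap Delta^-1 (F^(p-r)), in total degree n. *)
Definition cycles (S : finType) (K : {set {set S}}) (r p n : int) :
    {pred bichain K} :=
  fun x => (x \in filtered p n) && (Delta x \in filtered (p - r) (n + 1)).

(* Z_(r-1)^(p-1) + Delta Z_(r-1)^(p+r-1), in total degree n. *)
Definition boundaries (S : finType) (K : {set {set S}}) (r p n : int) :
    {pred bichain K} :=
  fun x => `[< exists y z : bichain K,
    [/\ y \in cycles (r - 1) (p - 1) n,
        z \in cycles (r - 1) (p + r - 1) (n - 1)
      & x = y + Delta z] >].

Section Closed.
Variables (S : finType) (K : {set {set S}}).

Lemma filtered_zmod_closed p n : zmod_closed (@filtered S K p n).
Proof.
split=> [|x y /forallP xF /forallP yF]; apply/forallP => st.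
  by rewrite ffunE eqxx.
apply/implyP; rewrite !ffunE => xy0.
have [x0|/(implyP (xF st))//] := eqVneq (x st) 0.
apply: (implyP (yF st)); apply: contraNneq xy0 => y0.
by rewrite x0 y0 subr0.
Qed.

HB.instance Definition _ p n :=
  GRing.isZmodClosed.Build (bichain K) (@filtered S K p n)
    (filtered_zmod_closed p n).

Lemma cycles_zmod_closed r p n : zmod_closed (@cycles S K r p n).
Proof.
split=> [|x y /andP[x1 x2] /andP[y1 y2]]; apply/andP.
  by rewrite raddf0 !rpred0.
by rewrite raddfB; split; apply: rpredB.
Qed.

HB.instance Definition _ r p n :=
  GRing.isZmodClosed.Build (bichain K) (@cycles S K r p n)
    (cycles_zmod_closed r p n).

Lemma boundaries_zmod_closed r p n : zmod_closed (@boundaries S K r p n).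
Proof.
split=> [|x x' /asboolP[y [z [yP zP ->]]] /asboolP[y' [z' [y'P z'P ->]]]];
  apply/asboolP.
  by exists 0, 0; split; rewrite ?rpred0 // raddf0 addr0.
exists (y - y'), (z - z'); split; rewrite ?rpredB // raddfB.
by rewrite opprD addrACA.
Qed.

HB.instance Definition _ r p n :=
  GRing.isZmodClosed.Build (bichain K) (@boundaries S K r p n)
    (boundaries_zmod_closed r p n).
End Closed.

(* E_r^(p,q)(K), in total degree q - p.  For r = 1 this is
   H^(q-p)(F^p / F^(p-1)). *)
Definition spectral (S : finType) (K : {set {set S}}) (r p q : int) : zmodType :=
  subquotient (@cycles S K r p (q - p)) (@boundaries S K r p (q - p)).

Definition cohomeology (S : finType) (K : {set {set S}}) (p q : int) : zmodType :=
  spectral K 2 p q.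

Definition free_of_rank (V : zmodType) (m : nat) : Prop :=
  exists b : 'I_m -> V, forall v : V,
    exists! c : {ffun 'I_m -> int}, v = \sum_(i < m) b i *~ c i.

(* Main.v *)
Require Import Defs.
From mathcomp Require Import all_boot all_order all_algebra.
From mathcomp Require Import ring_quotient boolp zify ring.

Set Implicit Arguments.
Unset Strict Implicit.
Unset Printing Implicit Defensive.

Import Order.TTheory GRing.Theory Num.Theory.
Local Open Scope ring_scope.
Local Open Scope quotient_scope.

(** Why the theorem holds.  In total degree 0 the filtered complex is spanned by
    the [sigma (x) sigma], so an element is a family of integers [x_sigma].  On
    such a diagonal family [Delta] is given by
      [(Delta x)_(a, b) = [b : a] * (x_b + (-1)^|a| x_a)]
    where [[b : a]] is the incidence number, which is a sign when [a] is a facet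
    of [b] and 0 otherwise: the boundary and the coboundary share the same
    incidence numbers ([boundary_incidence], [coboundary_incidence]).
    Nothing lives in total degree -1, so no [Delta z] has to be divided out, and
    two elements of [Z_2^n] agree in [E_2^(n,n)] iff their coefficients on
    [n]-simplices agree.  Belonging to [Z_2^n] means that
    [x_b + (-1)^|a| x_a = 0] for all facets [a] of [b] with [dim a >= n - 1].
    For [dim a = n] this forces [x_a = 0] as soon as [a] has a coface, because
    [x_b = 0] above dimension [n]; for [dim a = n - 1] it says that all
    [n]-simplices around [a] have the same coefficient, and determines [x_a].
    Hence the coefficients on [n]-simplices of a cycle are exactly the functions
    that are constant on the classes of [n]-simplices linked through common
    nonempty facets, and that vanish on a class having a member with a coface.
    So the group is free on the classes all of whose members are maximal
    simplices ([free_cohomeology]).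

    It remains to match these classes with components.  The subcomplex generated
    by a class is completely connected, and the union of two completely
    connected subcomplexes is completely connected when a top-dimensional
    simplex of one of them lies in both.  Therefore a component [L] of dimension
    [n] contains the whole class of each of its [n]-simplices, and no member of
    this class has a coface [t], since otherwise the subcomplex generated by the
    class of [t] could be added to [L].  Conversely a class of maximal simplices
    generates a subcomplex contained in some component, which cannot acquire
    further [n]-simplices or simplices of a higher dimension; and two components
    with a common [n]-simplex have a completely connected union, hence coincide.
    The argument uses only these closure properties, so [card_components] runs
    it for an arbitrary property of subcomplexes, which is then specialised to
    complete connectedness with and without connectedness. *)

(** * Free subquotients *)

(** A basis of [Z / B] is handled through representatives in [V], so that later
    arguments deal with coefficients of bichains and not with cosets. *)
Lemma free_subquotient (V : zmodType) (Z B : zmodClosed V) m (e : 'I_m -> V) :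
  (forall i, e i \in Z) ->
  (forall x, x \in Z ->
     exists! c : {ffun 'I_m -> int}, x - \sum_(i < m) e i *~ c i \in B) ->
  free_of_rank (subquotient Z B) m.
Proof.
move=> eZ basis.
pose e' i : subgroup_type Z := Sub (e i) (eZ i).
pose pr : subgroup_type Z -> subquotient Z B := \pi_(Quotient.quot _).
exists (fun i => pr (e' i)) => v.
have coords (x : subgroup_type Z) (c : {ffun 'I_m -> int}) :
    pr x = \sum_(i < m) pr (e' i) *~ c i <-> val x - \sum_(i < m) e i *~ c i \in B.
  have -> : \sum_(i < m) pr (e' i) *~ c i = pr (\sum_(i < m) e' i *~ c i).
    rewrite /pr raddf_sum; apply: eq_bigr => i _; by rewrite raddfMz.
  have -> : \sum_(i < m) e i *~ c i = val (\sum_(i < m) e' i *~ c i).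
    by rewrite raddf_sum; apply: eq_bigr => i _; rewrite raddfMz.
  rewrite -raddfB; split=> [/eqP|xB].
    by rewrite /pr -Quotient.idealrBE.
  by apply/eqP; rewrite /pr -Quotient.idealrBE.
rewrite -[v]reprK -/(pr _).
have [c [cP cU]] := basis _ (valP (repr v)).
by exists c; split=> [|c' /coords]; [apply/coords | apply: cU].
Qed.

(** * Incidence numbers and the differential on the diagonal *)

Section Incidence.
Variable S : finType.

(** The vertex order in which [enum] lists a set, and by which [inversions]
    counts. *)
Definition below (u v : S) := (enum_rank u < enum_rank v)%N.

Lemma pairwise_enum (A : {set S}) : pairwise below (enum A).
Proof.
suff : pairwise below (enum S).
  by rewrite enumT; apply: subseq_pairwise; apply: filter_subseq.
case E: (enum S) => [//|x0 s]; rewrite -E; apply/(pairwiseP x0) => i j.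
rewrite !inE -!cardE => iS jS ij.
rewrite /below -[i]/(val (Ordinal iS)) -[j]/(val (Ordinal jS)).
by rewrite -!enum_val_nth !enum_valK.
Qed.

Lemma pairwise_below_uniq s : pairwise below s -> uniq s.
Proof. by apply: pairwise_uniq => u; rewrite /below ltnn. Qed.

Lemma inversions_pairwise s : pairwise below s -> inversions s = 0%N.
Proof.
elim: s => //= v s IH /andP[/allP vs /IH ->]; rewrite addn0.
apply/eqP; rewrite -leqn0 leqNgt -has_count; apply/negP => /hasP[u /vs].
by rewrite /below => vu; rewrite ltnNge ltnW.
Qed.

Lemma index_pairwise s v : pairwise below s -> v \in s ->
  index v s = count (fun u => below u v) s.
Proof.
move=> ps vs; case/splitPr: vs ps => s1 s2; rewrite pairwise_cat /=.
case/and4P=> /allrelP s12 p1 /allP s2v p2.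
have vs1 : v \notin s1.
  apply/negP => vs1; have := s12 _ _ vs1 (mem_head _ _).
  by rewrite /below ltnn.
rewrite index_cat (negbTE vs1) /= eqxx addn0 count_cat /= {2}/below ltnn add0n.
rewrite (@eq_in_count _ _ predT s1) ?count_predT; last first.
  by move=> u us1 /=; rewrite s12 ?mem_head.
rewrite (@eq_in_count _ _ pred0 s2) ?count_pred0 ?addn0 // => u us2 /=.
by apply/negbTE; have := s2v u us2; rewrite /below -leqNgt; exact: ltnW.
Qed.

Variable K : {set {set S}}.
Implicit Types a b : simplex K.

Lemma oriented_pairwise s a : pairwise below s ->
  oriented K s a = (val a == [set v in s])%:R.
Proof.
move=> ps; rewrite ffunE pairwise_below_uniq // inversions_pairwise //=.
by case: eqP.
Qed.

Lemma oriented_enum a b : oriented K (enum (val a)) b = (a == b)%:R.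
Proof.
rewrite oriented_pairwise ?pairwise_enum //.
have -> : [set v in enum (val a)] = val a by apply/setP=> v; rewrite !inE mem_enum.
by rewrite eq_sym.
Qed.

(** The incidence number, written as a sum over the vertices that can be added
    to [a] to give [b]; there is at most one. *)
Definition incidence a b : int :=
  \sum_(v | (v \notin val a) && (val b == v |: val a))
    (-1) ^+ count (fun u => below u v) (enum (val a)).

Lemma coboundary_incidence a b : coboundary_seq K (enum (val a)) b = incidence a b.
Proof.
rewrite /coboundary_seq sum_ffunE /incidence [RHS]big_mkcond /=.
apply: eq_bigr => v _; rewrite ffunE /= mem_enum enum_uniq andbT.
have -> : [set u in v :: enum (val a)] = v |: val a.
  by apply/setP=> u; rewrite !inE mem_enum.
by rewrite (inversions_pairwise (pairwise_enum _)) addn0.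
Qed.

(** Deleting [v] from position [i] of [b] costs [(-1)^i], and putting [v] in
    front of the remaining vertices costs one sign for each of the vertices
    smaller than [v]; as [b] is listed in increasing order, these are the [i]
    vertices preceding [v]. *)
Lemma boundary_incidence a b : boundary_seq K (enum (val b)) a = incidence a b.
Proof.
rewrite /boundary_seq sum_ffunE /=.
transitivity (\sum_(v in val b)
  ((val a == val b :\ v)%:R *~ (-1) ^+ index v (enum (val b))) : int).
  rewrite -[RHS]big_enum /=; case E: (enum (val b)) => [|x0 s']; first by rewrite big_nil big_ord0.
  rewrite -E (big_nth x0) big_mkord; apply: eq_bigr => i _.
  rewrite index_uniq ?enum_uniq // ffunMzE; congr (_ *~ _).
  have bE : enum (val b) =
      take i (enum (val b)) ++ nth x0 (enum (val b)) i :: drop i.+1 (enum (val b)).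
    by rewrite -drop_nth ?cat_take_drop.
  move: (take _ _) (nth _ _ _) (drop _ _) bE => s1 v s2 bE.
  rewrite oriented_pairwise; last first.
    apply: subseq_pairwise (pairwise_enum (val b)); rewrite bE.
    by apply: cat_subseq => //; apply: subseq_cons.
  congr (_ == _)%:R; apply/setP => u; rewrite !inE -[u \in val b]mem_enum.
  have := enum_uniq (val b); rewrite bE cat_uniq /= !mem_cat inE.
  case/and4P=> _ /norP[vs1 _] vs2 _.
  by case: eqVneq => [->|//]; rewrite (negbTE vs1) (negbTE vs2).
rewrite /incidence [LHS]big_mkcond [RHS]big_mkcond; apply: eq_bigr => v _.
case: ifP => [vb|vb]; last first.
  case: ifP => // /andP[_ /eqP bE]; by rewrite bE setU11 in vb.
have -> : (val a == val b :\ v) = (v \notin val a) && (val b == v |: val a).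
  apply/eqP/andP => [->|[va /eqP->]]; last by rewrite setU1K.
  by rewrite setD11 setD1K.
case: andP => [[va /eqP bE]|_]; last by rewrite mul0rz.
rewrite index_pairwise ?pairwise_enum ?mem_enum //.
have : perm_eq (enum (val b)) (v :: enum (val a)).
  apply: uniq_perm; rewrite /= ?mem_enum ?va ?enum_uniq // => u.
  by rewrite inE !mem_enum bE !inE.
move=> /permP -> /=; rewrite {1}/below ltnn. by rewrite add0n /= intz.
Qed.

Lemma incidence0 a b : ~~ facet (val a) (val b) -> incidence a b = 0.
Proof.
move=> nab; apply: big1 => v /andP[va /eqP bE]; case/negP: nab.
by rewrite /facet bE subsetUr cardsU1 va add1n eqxx.
Qed.

Lemma incidence_neq0 a b : facet (val a) (val b) -> incidence a b != 0.
Proof.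
case/andP=> sab cab.
have /cards1P[v vE] : #|val b :\: val a| == 1%N.
  by rewrite cardsD (setIidPr sab) (eqP cab) subSnn.
rewrite /incidence (big_pred1 v) ?signr_eq0 // => u /=.
have bE : val b = v |: val a by rewrite -vE -{1}[val b](setID _ (val a)) (setIidPr sab) setUC.
apply/andP/eqP=> [[ua /eqP ub]|->]; last first.
  have : v \in val b :\: val a by rewrite vE inE.
  by rewrite inE => /andP[-> _]; rewrite bE.
by apply/set1P; rewrite -vE inE ua /= ub setU11.
Qed.

Lemma Delta_coef (x : bichain K) a b :
  Delta x (a, b) = \sum_s incidence a s * x (s, b)
     + (-1) ^+ #|val a| * \sum_t incidence t b * x (a, t).
Proof.
rewrite /Delta sum_ffunE.
rewrite (eq_bigr (fun st : simplex K * simplex K =>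
    incidence a st.1 * (st.2 == b)%:R * x (st.1, st.2)
    + (-1) ^+ #|val a| * (incidence st.2 b * (st.1 == a)%:R * x (st.1, st.2)))); last first.
  have tensorE (c d : chain K) u v : tensor c d (u, v) = c u * d v by rewrite ffunE.
  move=> [s t] _; rewrite ffunMzE [LHS]/= ffunE ffunMzE !tensorE !mulrzz /=.
  rewrite boundary_incidence coboundary_incidence !oriented_enum -cardE.
  by case: (s =P a) => [->|_] /=; ring.
rewrite big_split /= -mulr_sumr.
congr (_ + _ * _).
  rewrite -(pair_bigA _ (fun s t => incidence a s * (t == b)%:R * x (s, t))) /=.
  apply: eq_bigr => s _; rewrite (bigD1 b) //= eqxx mulr1 big1 ?addr0 // => t /negbTE ->.
  by rewrite mulr0 mul0r.
rewrite -(pair_bigA _ (fun s t => incidence t b * (s == a)%:R * x (s, t))) /=.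
rewrite (bigD1 a) //= [X in _ + X]big1 ?addr0 => [|s /negbTE ->].
  by apply: eq_bigr => t _; rewrite eqxx mulr1.
by apply: big1 => t _; rewrite mulr0 mul0r.
Qed.

(** A diagonal bichain reaches [(a, b)] only through the boundary of [b] in
    [b (x) b] and the coboundary of [a] in [a (x) a]. *)
Lemma Delta_diagonal (x : bichain K) a b :
  (forall s t, s != t -> x (s, t) = 0) ->
  Delta x (a, b) = incidence a b * (x (b, b) + (-1) ^+ #|val a| * x (a, a)).
Proof.
move=> xd; rewrite Delta_coef (bigD1 b) // (bigD1 (P := predT) a) //=.
rewrite !big1 => [|t ta|s /xd ->]; [by ring| |by rewrite mulr0].
by rewrite xd ?mulr0 // eq_sym.
Qed.

End Incidence.
(** * Classes of simplices linked through nonempty facets *)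

Section Classes.
Variables (S : finType) (K : {set {set S}}) (n : nat).
Hypothesis hK : simplicial_complex K.
Implicit Types (a b r s t : {set S}) (A B L M : {set {set S}}).

(** The common facet is required to be nonempty because the empty simplex does
    not occur in the chain groups.  This matters only for [n = 0], where the
    classes are then single vertices. *)
Definition adjacent : rel {set S} := fun a b =>
  [&& a \in K, b \in K, #|a| == n.+1, #|b| == n.+1
    & [exists r, [&& r != set0, facet r a & facet r b]]].

Definition strong_class a := [set b | connect adjacent a b].

Definition maximal a := [forall t in K, ~~ facet a t].

Definition class_maximal a := [forall b in strong_class a, maximal b].

Definition maximal_classes : {set {set {set S}}} :=
  [set strong_class a | a in [set a in K | (#|a| == n.+1) && class_maximal a]].

Lemma adjacent_sym : symmetric adjacent.
Proof.
have sub a b : adjacent a b -> adjacent b a.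
  case/and5P=> aK bK ca cb /existsP[r /and3P[r0 ra rb]].
  by apply/and5P; split=> //; apply/existsP; exists r; apply/and3P.
by move=> a b; apply/idP/idP; apply: sub.
Qed.

Lemma mem_strong_class a b : (b \in strong_class a) = connect adjacent a b.
Proof. by rewrite inE. Qed.

Lemma strong_class_refl a : a \in strong_class a.
Proof. by rewrite inE connect0. Qed.

Lemma strong_class_eq a b : b \in strong_class a -> strong_class b = strong_class a.
Proof.
rewrite inE => ab; apply/setP=> c; rewrite !inE.
by rewrite -(same_connect (sym_connect_sym adjacent_sym) ab).
Qed.

Lemma strong_class_simplex a b : a \in K -> #|a| = n.+1 -> b \in strong_class a ->
  b \in K /\ #|b| = n.+1.
Proof.
rewrite inE => aK ca /connectP[p]; elim: p a aK ca => [|c p IH] a aK ca /=.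
  by move=> _ ->.
by case/andP=> /and5P[_ cK _ /eqP cc _]; apply: IH.
Qed.

Lemma simplicial_complex_face s t : s \in K -> t \subset s -> t \in K.
Proof.
by case/and3P: hK => _ _ /forall_inP down sK ts; apply: (implyP (forallP (down s sK) t)).
Qed.

Lemma subcomplexP M : reflect
  [/\ set0 \in M, {subset M <= K} & forall s t, s \in M -> t \subset s -> t \in M]
  (subcomplex K M).
Proof.
apply: (iffP and3P) => [[M0 /subsetP MK /forall_inP down]|[M0 MK down]]; split=> //.
- by move=> s t sM ts; apply: (implyP (forallP (down s sM) t)).
- exact/subsetP.
- by apply/forall_inP => s sM; apply/forallP => t; apply/implyP; apply: down.
Qed.

Lemma subcomplexU A B : subcomplex K A -> subcomplex K B -> subcomplex K (A :|: B).
Proof.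
case/subcomplexP=> A0 AK Ad /subcomplexP[B0 BK Bd]; apply/subcomplexP; split.
- by rewrite inE A0.
- by move=> s /setUP[/AK|/BK].
- by move=> s t /setUP[] sM ts; apply/setUP; [left; apply: Ad ts|right; apply: Bd ts].
Qed.

Lemma exists_subset_card s k : (k <= #|s|)%N -> exists2 r : {set S}, r \subset s & #|r| = k.
Proof.
move=> ks; exists [set x in take k (enum s)].
  by apply/subsetP => x; rewrite inE => /mem_take; rewrite mem_enum.
rewrite cardsE (card_uniqP _) ?take_uniq ?enum_uniq //.
by rewrite size_take_min -cardE; apply/minn_idPl.
Qed.

Definition facet_step M k : rel {set S} := fun a b =>
  [&& a \in M, b \in M, #|a| == k, #|b| == k & share_facet a b].

Lemma completely_connected_stepP M : reflect
  (forall s t, s \in M -> t \in M -> #|s| = #|t| -> connect (facet_step M #|s|) s t)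
  (completely_connected M).
Proof.
apply: (iffP forall_inP) => [cc s t sM tM /eqP|cc s sM].
  exact: (implyP (forall_inP (cc s sM) t tM)).
by apply/forall_inP => t tM; apply/implyP => /eqP; apply: cc.
Qed.

Lemma facet_stepS M A k s t : A \subset M -> connect (facet_step A k) s t -> connect (facet_step M k) s t.
Proof.
move=> /subsetP AM; apply: connect_sub => a b /and5P[aA bA ca cb ab].
by apply: connect1; apply/and5P; split; rewrite ?AM.
Qed.

(** Above the size of [s0] all simplices belong to [B]; at any smaller size [s0]
    has a face of that size, through which the simplices of [A] and those of [B]
    are linked. *)
Lemma completely_connectedU A B s0 :
  subcomplex K A -> subcomplex K B -> s0 \in A -> s0 \in B ->
  (forall a, a \in A -> #|a| <= #|s0|)%N ->
  completely_connected A -> completely_connected B -> completely_connected (A :|: B).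
Proof.
move=> /subcomplexP[_ _ Ad] /subcomplexP[_ _ Bd] sA sB smax.
move=> /completely_connected_stepP ccA /completely_connected_stepP ccB.
apply/completely_connected_stepP => s t sM tM st.
have ccU M u v : M \subset A :|: B ->
   (forall s t, s \in M -> t \in M -> #|s| = #|t| -> connect (facet_step M #|s|) s t) ->
   u \in M -> v \in M -> #|u| = #|s| -> #|v| = #|s| ->
   connect (facet_step (A :|: B) #|s|) u v.
  by move=> MAB ccM uM vM us vs; rewrite -us; apply: facet_stepS MAB (ccM _ _ _ _ _); rewrite ?us.
have [small|] := leqP #|s| #|s0|; last first.
  move=> big; have inB u : u \in A :|: B -> #|u| = #|s| -> u \in B.
    by case/setUP=> // /smax + us; rewrite us leqNgt big.
  by apply: (ccU B); rewrite ?subsetUr ?inB.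
have [r rs0 rs] := exists_subset_card small.
have rA : r \in A by apply: Ad rs0.
have rB : r \in B by apply: Bd rs0.
apply: (@connect_trans _ _ r).
  by case/setUP: sM => sM; [apply: (ccU A)|apply: (ccU B)]; rewrite ?subsetUl ?subsetUr.
by case/setUP: tM => tM; [apply: (ccU A)|apply: (ccU B)]; rewrite ?subsetUl ?subsetUr.
Qed.

Lemma edge_connectedU A B s0 :
  subcomplex K A -> subcomplex K B -> s0 \in A -> s0 \in B -> s0 != set0 ->
  edge_connected A -> edge_connected B -> edge_connected (A :|: B).
Proof.
move=> /subcomplexP[_ _ Ad] /subcomplexP[_ _ Bd] sA sB /set0Pn[u us] ecA ecB.
have us1 : [set u] \subset s0 by rewrite sub1set.
have ecM M v w : M \subset A :|: B -> edge_connected M -> [set v] \in M -> [set w] \in M ->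
    connect [rel a b | [set a; b] \in A :|: B] v w.
  move=> /subsetP MAB /forallP/(_ v)/forallP/(_ w)/implyP ecM vM wM.
  have := implyP (ecM vM) wM.
  by apply: connect_sub => a b /= abM; apply: connect1; apply: MAB.
apply/forallP => v; apply/forallP => w; apply/implyP => vM; apply/implyP => wM.
have uA : [set u] \in A by apply: Ad us1.
have uB : [set u] \in B by apply: Bd us1.
apply: (@connect_trans _ _ u).
  by case/setUP: vM => vM; [apply: (ecM A)|apply: (ecM B)]; rewrite ?subsetUl ?subsetUr.
by case/setUP: wM => wM; [apply: (ecM A)|apply: (ecM B)]; rewrite ?subsetUl ?subsetUr.
Qed.

(** Faces of equal size of a simplex are linked by exchanging one vertex at a
    time. *)
Lemma connect_facet_step_simplex M b k s t : (forall r, r \subset b -> r \in M) ->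
  s \subset b -> t \subset b -> #|s| = k -> #|t| = k -> connect (facet_step M k) s t.
Proof.
move=> bM; move Em: #|s :\: t| => m.
elim: m s Em => [|m IH] s Em sb tb sk tk.
  suff -> : s = t by exact: connect0.
  apply/eqP; rewrite eqEcard sk tk leqnn andbT.
  by rewrite -setD_eq0 -cards_eq0 Em.
have : (0 < #|s :\: t|)%N by rewrite Em.
case/card_gt0P=> x; rewrite inE => /andP[xt xs].
have : (0 < #|t :\: s|)%N.
  have := cardsID t s; have := cardsID s t; rewrite setIC; lia.
case/card_gt0P=> y; rewrite inE => /andP[ys yt].
have ysx : y \notin s :\ x by rewrite inE negb_and ys orbT.
have cx := cardsD1 x s; rewrite xs sk in cx.
have cs' : #|y |: s :\ x| = k by rewrite cardsU1 ysx.
have s'b : y |: s :\ x \subset b.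
  by rewrite subUset sub1set (subsetP tb) // (subset_trans (subsetDl _ _)).
apply: (@connect_trans _ _ (y |: s :\ x)).
  apply: connect1; apply/and5P; split; rewrite ?bM ?sk ?cs' //.
  apply/existsP; exists (s :\ x); apply/andP; rewrite /facet subsetDl subsetUr /= sk cs'.
  by rewrite cx eqxx.
apply: IH => //.
have -> : (y |: s :\ x) :\: t = (s :\: t) :\ x.
  apply/setP => z; rewrite !inE; case: (eqVneq z y) => [->|_]; first by rewrite yt !(andbF, andbT).
  by rewrite /= andbCA.
have := cardsD1 x (s :\: t); rewrite Em inE xt xs; lia.
Qed.

Definition class_closure a : {set {set S}} :=
  [set s : {set S} | [exists b in strong_class a, s \subset b]].

Lemma class_closureP a s :
  reflect (exists2 b, b \in strong_class a & s \subset b) (s \in class_closure a).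
Proof. by rewrite inE; apply: (iffP exists_inP). Qed.

Lemma sub_class_closure a : strong_class a \subset class_closure a.
Proof. by apply/subsetP => b ba; apply/class_closureP; exists b. Qed.

Variable a0 : {set S}.
Hypotheses (a0K : a0 \in K) (ca0 : #|a0| = n.+1).

Lemma class_closure_subcomplex : subcomplex K (class_closure a0).
Proof.
apply/subcomplexP; split.
- by apply/class_closureP; exists a0; rewrite ?sub0set ?strong_class_refl.
- move=> s /class_closureP[b /(strong_class_simplex a0K ca0)[bK _]]; exact: simplicial_complex_face.
- move=> s t /class_closureP[b ba sb] ts; apply/class_closureP; exists b => //.
  exact: subset_trans sb.
Qed.

Lemma class_closure_face b r : b \in strong_class a0 -> r \subset b -> r \in class_closure a0.
Proof. by move=> ba rb; apply/class_closureP; exists b. Qed.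

(** Follow a chain of adjacent [n]-simplices: in a size at most [n], pass through
    a face of the common facet of two successive members; in size [n + 1], the
    chain itself is the required sequence. *)
Lemma class_closure_cc : completely_connected (class_closure a0).
Proof.
apply/completely_connected_stepP => s t /class_closureP[b ba sb] /class_closureP[c ca tc] st.
move Ek: #|s| st => k /esym tk.
have : connect adjacent b c by rewrite -mem_strong_class (strong_class_eq ba).
case/connectP=> p; elim: p b ba s sb Ek => [|b' p IH] b ba s sb sk /=.
  move=> _ cb; rewrite {}cb in tc.
  exact: connect_facet_step_simplex (fun r => class_closure_face ba) sb tc sk tk.
case/andP=> bb' pp lp.
have b'a : b' \in strong_class a0.
  rewrite mem_strong_class; apply: connect_trans (connect1 bb').
  by rewrite -mem_strong_class.
have [_ cb] := strong_class_simplex a0K ca0 ba.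
have /and5P[_ _ _ /eqP cb' /existsP[r /and3P[_ rb rb']]] := bb'.
have [kn|kn] := leqP k n.
  have rk : (k <= #|r|)%N by case/andP: rb => _ /eqP; rewrite cb; lia.
  have [u ur uk] := exists_subset_card rk.
  case/andP: rb rb' => rb _ /andP[rb' _].
  apply: (@connect_trans _ _ u).
    apply: connect_facet_step_simplex (fun r => class_closure_face ba) sb _ sk uk.
    exact: subset_trans rb.
  by apply: (IH b') => //; apply: subset_trans rb'.
have kE : k = n.+1 by apply/eqP; rewrite eqn_leq kn andbT -sk -cb subset_leq_card.
have sE : s = b by apply/eqP; rewrite eqEcard sb sk kE cb leqnn.
apply: (@connect_trans _ _ b'); last by apply: (IH b') => //; rewrite cb' kE.
apply: connect1; rewrite sE kE; apply/and5P; split; rewrite ?cb ?cb' //.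
- exact: class_closure_face ba (subxx _).
- exact: class_closure_face b'a (subxx _).
- by apply/existsP; exists r; rewrite rb rb'.
Qed.

Lemma class_closure_ec : edge_connected (class_closure a0).
Proof.
apply/forallP => v; apply/forallP => w; apply/implyP => vL; apply/implyP => wL.
move: vL wL => /class_closureP[b ba vb] /class_closureP[c ca wc].
rewrite !sub1set in vb wc.
have edge d x y : d \in strong_class a0 -> x \in d -> y \in d ->
    connect [rel a b | [set a; b] \in class_closure a0] x y.
  move=> da xd yd; apply: connect1; apply: class_closure_face da _.
  by rewrite subUset !sub1set xd yd.
have : connect adjacent b c by rewrite -mem_strong_class (strong_class_eq ba).
case/connectP=> p; elim: p b ba v vb => [|b' p IH] b ba v vb /=.
  by move=> _ cb; rewrite {}cb in wc; apply: edge ba vb wc.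
case/andP=> bb' pp lp.
have b'a : b' \in strong_class a0.
  rewrite mem_strong_class; apply: connect_trans (connect1 bb').
  by rewrite -mem_strong_class.
have /and5P[_ _ _ _ /existsP[r /and3P[/set0Pn[u ur] /andP[rb _] /andP[rb' _]]]] := bb'.
apply: (@connect_trans _ _ u); first exact: edge ba vb (subsetP rb _ ur).
by apply: (IH b') => //; apply: (subsetP rb').
Qed.

(** In positive dimension facets are nonempty, so linked [n]-simplices are
    adjacent. *)
Lemma cc_mem_strong_class M s : (0 < n)%N -> subcomplex K M -> completely_connected M ->
  a0 \in M -> s \in M -> #|s| = n.+1 -> s \in strong_class a0.
Proof.
move=> n0 /subcomplexP[_ MK _] /completely_connected_stepP ccM aM sM cs.
rewrite mem_strong_class; have := ccM a0 s aM sM; rewrite ca0 cs => /(_ erefl).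
apply: connect_sub => a b /and5P[aM' bM /eqP ca cb /existsP[r /andP[ra rb]]].
apply: connect1; apply/and5P; split; rewrite ?MK ?ca //.
apply/existsP; exists r; rewrite ra rb !andbT -cards_eq0.
by case/andP: ra => _; rewrite ca eqSS => /eqP <-; rewrite -lt0n.
Qed.

(** In dimension 0, an edge path leaving a vertex that is a maximal simplex would
    start with an edge containing it. *)
Lemma ec_mem_strong_class M s : n = 0%N -> subcomplex K M -> edge_connected M ->
  maximal a0 -> a0 \in M -> s \in M -> #|s| = n.+1 -> s \in strong_class a0.
Proof.
move=> n0 /subcomplexP[_ MK _] ecM maxa aM sM cs.
have /cards1P[v vE] : #|a0| == 1%N by rewrite ca0 n0.
have /cards1P[w wE] : #|s| == 1%N by rewrite cs n0.
move: aM sM; rewrite wE vE => vM wM.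
have := implyP (implyP (forallP (forallP ecM v) w) vM) wM.
suff cl : closed [rel a b | [set a; b] \in M] (pred1 v).
  move/(closed_connect cl); rewrite !inE eqxx => /esym/eqP wv.
  by rewrite wv connect0.
apply: intro_closed => [|x y /= xyM /eqP xv].
  by apply: sym_connect_sym => x y /=; rewrite setUC.
apply: contraT => yv; have := forall_inP maxa _ (MK _ xyM).
rewrite /facet vE xv subsetUl /= cards1 cards2.
by move: yv; rewrite inE eq_sym => ->.
Qed.

End Classes.

(** * Components correspond to classes of maximal simplices *)

(** [Q] stands for complete connectedness, with or without connectedness: the
    hypotheses below are all that the correspondence requires of it. *)
Section Counting.
Variables (S : finType) (K : {set {set S}}) (n : nat) (Q : pred {set {set S}}).
Hypothesis QK : forall M, Q M -> subcomplex K M.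
Hypothesis QU : forall A B (s : {set S}), Q A -> Q B -> s \in A -> s \in B ->
  s != set0 -> (forall a, a \in A -> #|a| <= #|s|)%N -> Q (A :|: B).
Hypothesis Qclosure : forall m (a : {set S}), a \in K -> #|a| = m.+1 ->
  Q (class_closure K m a).
Hypothesis Qclass : forall M (a s : {set S}), Q M -> #|a| = n.+1 -> class_maximal K n a ->
  a \in M -> s \in M -> #|s| = n.+1 -> s \in strong_class K n a.

Let components := [set L | maxset Q L & of_dim L n].
(* A component is recovered from its simplices of top dimension. *)
Let layer (L : {set {set S}}) := [set s in L | #|s| == n.+1].

Lemma of_dimP (L : {set {set S}}) : reflect
  ((exists2 a, a \in L & #|a| = n.+1) /\ (forall s, s \in L -> #|s| <= n.+1)%N)
  (of_dim L n).
Proof.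
have ub s : s \in L -> (#|s| <= \max_(t in L) #|t|)%N by move=> sL; exact: leq_bigmax_cond.
apply: (iffP eqP) => [dimL|[[a aL ca] small]].
  split=> [|s]; last by rewrite -dimL; exact: ub.
  have [L0|] := eqVneq L set0; first by rewrite L0 big_set0 in dimL.
  rewrite -card_gt0 => /(eq_bigmax_cond (fun s => #|pred_of_set s|))[a aL].
  by rewrite dimL => ca; exists a.
apply/eqP; rewrite eqn_leq; apply/andP; split; first exact/bigmax_leqP.
by rewrite -ca ub.
Qed.

Lemma maxset_absorb L A (s : {set S}) : maxset Q L -> Q A -> s \in L -> s \in A ->
  s != set0 -> (forall a, a \in L -> #|a| <= #|s|)%N \/ (forall a, a \in A -> #|a| <= #|s|)%N ->
  A \subset L.
Proof.
move=> /maxsetP[QL Lmax] QA sL sA s0 small; rewrite -(Lmax (L :|: A)) ?subsetUl ?subsetUr //.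
by case: small => small; [apply: QU small|rewrite setUC; apply: QU small].
Qed.

Lemma card_neq_set0 m (s : {set S}) : #|s| = m.+1 -> s != set0.
Proof. by rewrite -cards_eq0 => ->. Qed.

(** If a member [b] of the class of [a] had a coface [t], then the subcomplex
    generated by the class of [t] could be glued to [L] along [b], where [L] has
    its top dimension. *)
Lemma layer_component L (a : {set S}) : L \in components -> a \in L -> #|a| = n.+1 ->
  class_maximal K n a /\ layer L = strong_class K n a.
Proof.
rewrite inE => /andP[mL /of_dimP[_ small]] aL ca.
have QL := maxsetp mL.
have /subcomplexP[_ LK _] := QK QL.
have aK := LK _ aL.
have classL : class_closure K n a \subset L.
  apply: (maxset_absorb mL (Qclosure aK ca) aL _ (card_neq_set0 ca)).
    exact: subsetP (sub_class_closure _ _ _) _ (strong_class_refl _ _ _).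
  by left; rewrite ca.
have {}classL b : b \in strong_class K n a -> b \in L.
  by move/(subsetP (sub_class_closure _ _ _)); apply: subsetP.
have ta : class_maximal K n a.
  apply/forall_inP => b ba; apply/forall_inP => t tK; apply/negP => bt.
  have [bK cb] := strong_class_simplex aK ca ba.
  have ct : #|t| = n.+2 by case/andP: bt => _ /eqP ->; rewrite cb.
  have tt := subsetP (sub_class_closure _ _ _) _ (strong_class_refl K n.+1 t).
  have tL : t \in L.
    apply: (subsetP (maxset_absorb mL (Qclosure tK ct) (classL _ ba) _ (card_neq_set0 cb) _)) => //.
      case/andP: bt => bt _; exact: class_closure_face (strong_class_refl _ _ _) bt.
    by left; rewrite cb.
  by have := small _ tL; rewrite ct ltnn.
split=> //; apply/setP => s; rewrite inE; apply/andP/idP => [[sL /eqP cs]|sa].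
  exact: Qclass QL ca ta aL sL cs.
by rewrite classL //; have [_ ->] := strong_class_simplex aK ca sa.
Qed.

Lemma card_components : #|components| = #|maximal_classes K n|.
Proof.
have layer_inj : {in components &, injective layer}.
  move=> L L' LC L'C LL'.
  have := LC; have := L'C; rewrite !inE => /andP[mL' /of_dimP[_ small']].
  case/andP=> [mL /of_dimP[[a aL ca] small]].
  have : a \in layer L by rewrite inE aL ca eqxx.
  rewrite LL' inE => /andP[aL' _].
  apply/eqP; rewrite eqEsubset; apply/andP; split.
    by apply: (maxset_absorb mL' (maxsetp mL) aL' aL (card_neq_set0 ca)); left; rewrite ca.
  by apply: (maxset_absorb mL (maxsetp mL') aL aL' (card_neq_set0 ca)); left; rewrite ca.
rewrite -(card_in_imset layer_inj); congr #|pred_of_set _|; apply/setP => C.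
apply/imsetP/imsetP => [[L LC ->]|[a]].
  have := LC; rewrite inE => /andP[mL /of_dimP[[a aL ca] _]].
  have [ta layerE] := layer_component LC aL ca.
  exists a => //; rewrite inE ca eqxx ta !andbT.
  by have /subcomplexP[_ LK _] := QK (maxsetp mL); apply: LK.
rewrite inE => /and3P[aK /eqP ca ta] ->.
have [L mL clL] := maxset_exists (Qclosure aK ca).
have QL := maxsetp mL.
have /subcomplexP[_ LK Ld] := QK QL.
have aL : a \in L.
  apply: (subsetP clL); apply: (subsetP (sub_class_closure _ _ _)).
  exact: strong_class_refl.
have LC : L \in components.
  rewrite inE mL; apply/of_dimP; split; first by exists a.
  move=> t tL; rewrite leqNgt; apply/negP => ct.
  (* A larger simplex of L has a face with n + 2 vertices, hence an n-simplex
     which has a coface although it lies in the class of a. *)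
  have [t' t't ct'] := exists_subset_card ct.
  have [s st' cs] := @exists_subset_card _ t' n.+1 (leq_trans (leqnSn _) (eq_leq (esym ct'))).
  have t'L := Ld _ _ tL t't.
  have sa := Qclass QL ca ta aL (Ld _ _ t'L st') cs.
  have := forall_inP (forall_inP ta _ sa) _ (LK _ t'L).
  by rewrite /facet st' cs ct' eqxx.
by exists L => //; have [] := layer_component LC aL ca.
Qed.

End Counting.

Lemma card_cc_components (S : finType) (K : {set {set S}}) n :
  simplicial_complex K -> (0 < n)%N -> #|cc_components K n| = #|maximal_classes K n|.
Proof.
move=> hK n0.
apply: (@card_components _ _ _ (fun M => subcomplex K M && completely_connected M)).
- by move=> M /andP[].
- move=> A B s /andP[sA cA] /andP[sB cB] a b _ small.
  by rewrite subcomplexU // (completely_connectedU sA sB a b).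
- by move=> m a aK ca; rewrite class_closure_subcomplex ?class_closure_cc.
- move=> M a s /andP[sM cM] ca _ aM.
  exact: (cc_mem_strong_class ca n0 sM cM aM).
Qed.

Lemma card_connected_cc_components (S : finType) (K : {set {set S}}) n :
  simplicial_complex K -> #|connected_cc_components K n| = #|maximal_classes K n|.
Proof.
move=> hK.
apply: (@card_components _ _ _
  (fun M => [&& subcomplex K M, completely_connected M & edge_connected M])).
- by move=> M /andP[].
- move=> A B s /and3P[sA cA eA] /and3P[sB cB eB] a b s0 small.
  by rewrite subcomplexU // (completely_connectedU sA sB a b) ?(edge_connectedU sA sB a b).
- by move=> m a aK ca; rewrite class_closure_subcomplex ?class_closure_cc ?class_closure_ec.
- move=> M a s /and3P[sM cM eM] ca /forall_inP ta aM.
  have [n0|] := posnP n; last by move=> n0; exact: (cc_mem_strong_class ca n0 sM cM aM).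
  exact: (ec_mem_strong_class ca n0 sM eM (ta _ (strong_class_refl _ _ _)) aM).
Qed.

(** * The cohomeology group on the diagonal *)

Section Rank.
Variables (S : finType) (K : {set {set S}}) (n : nat).
Hypothesis hK : simplicial_complex K.
Implicit Types (a b s t : simplex K) (x : bichain K).

Lemma simplex_mem s : val s \in K. Proof. by case/andP: (valP s). Qed.
Lemma simplex_neq0 s : val s != set0. Proof. by case/andP: (valP s). Qed.

Lemma simplex_ex (A : {set S}) : A \in K -> A != set0 -> exists s, val s = A.
Proof. by move=> AK A0; exists (Sub A (introT andP (conj AK A0))). Qed.

Lemma simplex_ex_card m (A : {set S}) : A \in K -> #|A| = m.+1 -> exists s, val s = A.
Proof. by move=> AK cA; apply: simplex_ex => //; rewrite -cards_eq0 cA. Qed.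

Definition diagonal x := forall s t, s != t -> x (s, t) = 0.

(** The bound on [#|val a|] is [dim a >= n - 1]: these are the coefficients of
    [Delta x] that membership in [F^(n-2)] requires to vanish. *)
Definition compatible x := forall a b, facet (val a) (val b) -> (n <= #|val a|)%N ->
  x (b, b) + (-1) ^+ #|val a| * x (a, a) = 0.

Lemma filtered0P (p : int) x : reflect
  (diagonal x /\ forall s, x (s, s) != 0 -> sdim s <= p)
  (x \in filtered p 0).
Proof.
apply: (iffP forallP) => [F|[xd xp] [s t]].
  split=> [s t st|s xs]; last by have /and3P[] := implyP (F (s, s)) xs.
  apply/eqP/contraT => /(implyP (F (s, t)))/and3P[/= sub dim _].
  case/eqP: st; apply/val_inj/eqP; rewrite eqEcard sub /=.
  move: dim; rewrite /sdim /=; lia.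
apply/implyP => /= xst.
have st : s = t by apply/eqP; apply: contraNT xst => /xd ->.
by rewrite -st in xst *; rewrite subxx subrr eqxx xp.
Qed.

Lemma Delta_filtered x : diagonal x -> reflect (compatible x) (Delta x \in filtered (n%:Z - 2) 1).
Proof.
move=> xd; apply: (iffP forallP) => [F a b fab na|xc [a b]].
  have := F (a, b); rewrite Delta_diagonal // mulf_eq0 negb_or incidence_neq0 //=.
  case: eqP => //= _ /and3P[_ _]; rewrite /sdim; lia.
apply/implyP; rewrite Delta_diagonal // mulf_eq0 negb_or => /andP[iab xab].
have fab : facet (val a) (val b) by apply: contraNT iab => /incidence0 ->.
rewrite /= /sdim; have /andP[-> /eqP cab] := fab.
have : (#|val a| < n)%N by rewrite ltnNge; apply: contraNN xab => na; rewrite xc.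
lia.
Qed.

Lemma cycles2P x : reflect
  [/\ diagonal x, compatible x & forall s, (n.+1 < #|val s|)%N -> x (s, s) = 0]
  (x \in cycles 2 n%:Z (n%:Z - n%:Z)).
Proof.
rewrite subrr; apply: (iffP andP) => [[/filtered0P[xd xs] xD]|[xd xc xs]].
  split=> //; first by apply/Delta_filtered.
  move=> s cs; apply/eqP/contraT => /xs; rewrite /sdim; lia.
split; last exact/Delta_filtered.
apply/filtered0P; split=> // s; rewrite leNgt; apply: contra => cs.
by apply/eqP/xs; move: cs; rewrite /sdim; lia.
Qed.

Lemma filteredN1 (p : int) x : x \in filtered p (-1) -> x = 0.
Proof.
move=> /forallP F; apply/ffunP => -[s t]; rewrite ffunE; apply/eqP/contraT.
case/(implyP (F (s, t)))/and3P => /= /subset_leq_card; rewrite /sdim /=; lia.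
Qed.

Lemma boundaries2P x : x \in cycles 2 n%:Z (n%:Z - n%:Z) -> reflect
  (forall s, #|val s| = n.+1 -> x (s, s) = 0)
  (x \in boundaries 2 n%:Z (n%:Z - n%:Z)).
Proof.
case/cycles2P => xd xc xs; rewrite subrr.
apply: (iffP (asboolP _)) => [[y [z [/andP[/filtered0P[_ yn] _] + ->]]] s cs|x0].
  case/andP=> /filteredN1 -> _; rewrite raddf0 addr0.
  apply/eqP/contraT => /yn; rewrite /sdim cs; lia.
exists x, 0; rewrite rpred0 raddf0 addr0; split=> //.
have -> : 2 - 1 = 1 :> int by [].
apply/andP; split; last by rewrite -addrA; apply/Delta_filtered.
apply/filtered0P; split=> // s; rewrite leNgt; apply: contra => cs; apply/eqP.
case: (ltngtP #|val s| n.+1) => [|/xs //|/x0 //]; move: cs; rewrite /sdim; lia.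
Qed.

(** Two adjacent [n]-simplices both determine the coefficient of their common
    facet, by the same formula. *)
Lemma compatible_class x s t : compatible x ->
  #|val s| = n.+1 -> val t \in strong_class K n (val s) -> x (t, t) = x (s, s).
Proof.
move=> xc; rewrite inE => + /connectP[p].
elim: p s => [|b' p IH] s cs /=; first by move=> _ ts; have -> : t = s by exact: val_inj.
case/andP=> /and5P[_ bK _ /eqP cb /existsP[r /and3P[r0 rs rb]]].
have [b bE] := simplex_ex_card bK cb.
have [u uE] : exists u : simplex K, val u = r.
  apply: simplex_ex => //; apply: (simplicial_complex_face hK (simplex_mem s)).
  by case/andP: rs.
rewrite -bE -uE in cb rs rb *; move=> pp tp; rewrite (IH b) //.
have nu : (n <= #|val u|)%N by case/andP: rs => _; rewrite cs; lia.
by apply: (addIr ((-1) ^+ #|val u| * x (u, u))); rewrite !xc.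
Qed.

(** If a simplex [b] of the class has a coface, then [x] vanishes on this coface,
    hence on [b], hence on the class. *)
Lemma compatible_maximal x s : compatible x -> (forall s, (n.+1 < #|val s|)%N -> x (s, s) = 0) ->
  #|val s| = n.+1 -> x (s, s) != 0 -> class_maximal K n (val s).
Proof.
move=> xc xs cs xs0; apply/forall_inP => b bs; apply/forall_inP => t tK; apply/negP => bt.
have [bK cb] := strong_class_simplex (simplex_mem s) cs bs.
have ct : #|t| = n.+2 by case/andP: bt => _ /eqP ->; rewrite cb.
have [t' tE] := simplex_ex_card tK ct; have [b' bE] := simplex_ex_card bK cb.
rewrite -tE -bE in bs bt cb ct; case/eqP: xs0.
rewrite -(compatible_class xc cs bs); have := xc _ _ bt.
rewrite cb leqnSn xs ?ct // add0r => /(_ isT)/eqP.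
by rewrite mulf_eq0 signr_eq0 => /eqP.
Qed.

(** The cycle attached to a class: 1 on its members, completed on their facets by
    the only value that compatibility allows there. *)
Definition class_chain (C : {set {set S}}) : bichain K :=
  [ffun st => if st.1 != st.2 then 0 else
     if val st.1 \in C then 1
     else if [exists b in C, facet (val st.1) b] then (-1) ^+ n.+1 else 0].

Lemma maximal_classP C : C \in maximal_classes K n ->
  exists a, [/\ C = strong_class K n (val a), #|val a| = n.+1 & class_maximal K n (val a)].
Proof.
case/imsetP=> A; rewrite inE => /and3P[AK /eqP cA tA] ->.
by have [a aE] := simplex_ex_card AK cA; exists a; rewrite aE.
Qed.

Lemma class_chainE C s : class_chain C (s, s) =
  if val s \in C then 1
  else if [exists b in C, facet (val s) b] then (-1) ^+ n.+1 else 0.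
Proof. by rewrite ffunE eqxx. Qed.

(** Only a facet [s] of [t] with [dim s] equal to [n - 1] or [n] matters.  In the
    first case [s] lies under a member of the class iff [t] is itself a member,
    since all [n]-simplices containing [s] are adjacent.  In the second case [s]
    is not in the class, as it is not maximal. *)
Lemma class_chain_cycle C : C \in maximal_classes K n ->
  class_chain C \in cycles 2 n%:Z (n%:Z - n%:Z).
Proof.
case/maximal_classP=> a [CE ca ta].
have cC (b : {set S}) : b \in C -> #|b| = n.+1.
  by rewrite CE => /(strong_class_simplex (simplex_mem a) ca)[].
have high (s : simplex K) : (n < #|val s|)%N -> [exists b in C, facet (val s) b] = false.
  move=> ns; apply/negbTE/negP.
  move=> /exists_inP[b /cC cb /andP[_]]; rewrite cb; lia.
apply/cycles2P; split=> [s t st|s t fst ns|s ns]; first by rewrite ffunE /= st.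
  have ct : #|val t| = #|val s|.+1 by case/andP: fst => _ /eqP.
  rewrite !class_chainE (high t) ?ct //.
  have [ns1|sn] := ltnP n #|val s|.
    have -> : (val t \in C) = false by apply/negP => /cC; rewrite ct; lia.
    rewrite high //; case: ifP => sC; last by rewrite mulr0 addr0.
    rewrite CE in sC.
    by have := forall_inP (forall_inP ta _ sC) _ (simplex_mem t); rewrite fst.
  have sE : #|val s| = n by apply/eqP; rewrite eqn_leq ns sn.
  have -> : (val s \in C) = false by apply/negP => /cC; rewrite sE; lia.
  rewrite sE.
  have -> : [exists b in C, facet (val s) b] = (val t \in C).
    apply/exists_inP/idP => [[b bC sb]|tC]; last by exists (val t).
    rewrite CE; rewrite CE in bC; have [bK cb] := strong_class_simplex (simplex_mem a) ca bC.
    rewrite -(strong_class_eq bC) inE; apply: connect1; apply/and5P.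
    split; rewrite ?bK ?cb ?ct ?sE ?simplex_mem //.
    by apply/existsP; exists (val s); rewrite simplex_neq0 sb fst.
  case: ifP => _; last by rewrite mulr0 addr0.
  by rewrite exprS mulrCA -expr2 sqrr_sign mulr1 subrr.
rewrite class_chainE high 1?ltnW //.
by have -> : (val s \in C) = false by apply/negP => /cC; lia.
Qed.

Lemma maximal_classes_disjoint C D (s : {set S}) : C \in maximal_classes K n -> D \in maximal_classes K n ->
  s \in C -> s \in D -> C = D.
Proof.
case/maximal_classP=> a [-> _ _] /maximal_classP[b [-> _ _]] sa sb.
by rewrite -(strong_class_eq sa) -(strong_class_eq sb).
Qed.

(** The coordinates of a cycle are its values on one representative of each class
    of maximal simplices. *)
Lemma free_cohomeology : free_of_rank (cohomeology K n%:Z n%:Z) #|maximal_classes K n|.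
Proof.
pose C (i : 'I_#|maximal_classes K n|) := enum_val i.
have CP i : C i \in maximal_classes K n := enum_valP i.
have /choice[rep repP] : forall i, exists a, [/\ C i = strong_class K n (val a),
    #|val a| = n.+1 & class_maximal K n (val a)] by move=> i; apply: maximal_classP.
have repC i : val (rep i) \in C i by case: (repP i) => -> _ _; apply: strong_class_refl.
have CE i j : (val (rep i) \in C j) = (i == j).
  apply/idP/eqP => [ij|<- //].
  by apply/enum_val_inj/(maximal_classes_disjoint (CP i) (CP j) (repC i) ij).
apply: (@free_subquotient _ _ _ _ (fun i => class_chain (C i))) => [i|x xZ].
  exact: class_chain_cycle (CP i).
have sumE (c : {ffun 'I_#|maximal_classes K n| -> int}) s : #|val s| = n.+1 ->
    (\sum_i class_chain (C i) *~ c i) (s, s) = \sum_(i | val s \in C i) c i.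
  move=> cs; rewrite sum_ffunE [RHS]big_mkcond; apply: eq_bigr => i _.
  rewrite ffunMzE class_chainE; case: ifP => [_|sC]; first by rewrite intz.
  case: ifP => [/exists_inP[b bC /andP[_]]|_]; last by rewrite mul0rz.
  have [Ci ca _] := repP i; rewrite Ci in bC.
  by have [_ ->] := strong_class_simplex (simplex_mem _) ca bC; rewrite cs; lia.
have sum_rep (c : {ffun 'I_#|maximal_classes K n| -> int}) i :
    (\sum_i class_chain (C i) *~ c i) (rep i, rep i) = c i.
  have [_ ci _] := repP i.
  by rewrite sumE // (big_pred1 i) // => j /=; rewrite CE eq_sym.
have dZ (c : {ffun 'I_#|maximal_classes K n| -> int}) :
    x - \sum_i class_chain (C i) *~ c i \in cycles 2 n%:Z (n%:Z - n%:Z).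
  rewrite rpredB // rpred_sum // => i _.
  by rewrite rpredMz // class_chain_cycle.
have /cycles2P[xd xc xs] := xZ.
exists [ffun i => x (rep i, rep i)]; split=> [|c /(boundaries2P (dZ c)) xB].
  apply/(boundaries2P (dZ _)) => s cs; rewrite !ffunE sumE //.
  case: (pickP (fun i => val s \in C i)) => [i sC|noC].
    have [Ci ci _] := repP i.
    rewrite (big_pred1 i) => [|j /=].
      by rewrite ffunE (compatible_class xc ci) ?subrr -?Ci.
    apply/idP/eqP => [sj|-> //].
    exact/enum_val_inj/(maximal_classes_disjoint (CP j) (CP i) sj sC).
  rewrite big_pred0 // subr0; apply/eqP/contraT => xs0.
  have sT : strong_class K n (val s) \in maximal_classes K n.
    by apply: imset_f; rewrite inE simplex_mem cs eqxx (compatible_maximal xc).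
  have := noC (enum_rank_in sT (strong_class K n (val s))).
  by rewrite /C enum_rankK_in // strong_class_refl.
apply/ffunP => i; rewrite ffunE; have [_ ci _] := repP i.
by have := xB _ ci; rewrite !ffunE sum_rep => /eqP; rewrite subr_eq0 => /eqP.
Qed.

End Rank.

Theorem theorem6p3 (S : finType) (K : {set {set S}}) (n : nat)
    (hK : simplicial_complex K) :
  ((0 < n)%N ->
     free_of_rank (cohomeology K n%:Z n%:Z) #|cc_components K n|) /\
  free_of_rank (cohomeology K n%:Z n%:Z) #|connected_cc_components K n|.
Proof.
split=> [n0|].
  by rewrite card_cc_components //; apply: free_cohomeology.
by rewrite card_connected_cc_components //; apply: free_cohomeology.
Qed.
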